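(* Let $K$ be a field. Suppose that $(n_1,n_2,n_3)$ is one of the following triples of integers: (i) $(n_1,n_2,n_3)=(k_1,1,1)$ with $2\le k_1\le 10$; (ii) $(n_1,n_2,n_3)=(k_2,k_3,1)$ with $2\le k_2\le 4$ and $2\le k_3\le 4$; (iii) $(n_1,n_2,n_3)=(k_4,k_5,k_6)$ with $2\le k_4,k_5,k_6\le 3$. Then the join-meet ideal $I_{L_3(n_1,n_2,n_3)}\subset K[L_3(n_1,n_2,n_3)]$ is a radical ideal.
   Context: For a finite lattice $L$ and a field $K$, $K[L]$ denotes the polynomial ring over $K$ whose variables $x_a$ are indexed by the elements $a\in L$. The join-meet ideal of $L$ is $I_L=(\{x_ax_b-x_{a\vee b}x_{a\wedge b}\mid a,b\in L\})\subset K[L]$. For integers $n_1,n_2,n_3\ge 1$, $L_3(n_1,n_2,n_3)=\{s,a_1,\dots,a_{n_1},b_1,\dots,b_{n_2},c_1,\dots,c_{n_3},t\}$ is the finite lattice with $n_1+n_2+n_3+2$ distinct elements whose order is generated by $s<a_1<\cdots<a_{n_1}<t$, $s<b_1<\cdots<b_{n_2}<t$ and $s<c_1<\cdots<c_{n_3}<t$; thus two elements lying in different ones of the three chains $\{a_i\},\{b_i\},\{c_i\}$ are incomparable, with join $t$ and meet $s$. *)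

(* Defs.v *)
From HB Require Import structures.
From mathcomp Require Import all_boot all_order all_algebra.
From mathcomp Require Import mpoly.

Set Implicit Arguments.
Unset Strict Implicit.
Unset Printing Implicit Defensive.

Import Order.TTheory GRing.Theory.

(* Ideals are Prop-valued, since membership in a generated ideal is not
   decidable for an abstract coefficient field. *)
Section Ideals.
Local Open Scope ring_scope.
Variable R : comNzRingType.

Definition generated_ideal (G : R -> Prop) (p : R) : Prop :=
  exists2 c : seq (R * R),
    forall u, u \in c -> G u.2 & p = \sum_(u <- c) u.1 * u.2.

Definition radical (I : R -> Prop) (p : R) : Prop :=
  exists2 m : nat, (0 < m)%N & I (p ^+ m).

Definition radical_ideal (I : R -> Prop) : Prop :=
  forall p, radical I p <-> I p.

End Ideals.

Section JoinMeetIdeal.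
Variables (K : fieldType) (d : Order.disp_t) (L : finLatticeType d).

(* K[L] is {mpoly K[#|L|]}; the variable x_a carries the number of a in the
   enumeration of L. *)
Definition latvar (a : L) : {mpoly K[#|L|]} := ('X_(enum_rank a))%R.

Definition join_meet_generator (p : {mpoly K[#|L|]}) : Prop :=
  exists a b : L,
    p = (latvar a * latvar b
         - latvar (Order.join a b) * latvar (Order.meet a b))%R.

Definition join_meet_ideal : {mpoly K[#|L|]} -> Prop :=
  generated_ideal join_meet_generator.

End JoinMeetIdeal.

Arguments latvar K {d} {L} a.
Arguments join_meet_generator K {d} L p.
Arguments join_meet_ideal K {d} L _.

(* The chains are indexed from 0: the mathematical a_i is L3a (i - 1). *)
Inductive L3 (n1 n2 n3 : nat) : Type :=
  | L3s
  | L3a of 'I_n1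
  | L3b of 'I_n2
  | L3c of 'I_n3
  | L3t.

Arguments L3s {n1 n2 n3}.
Arguments L3a {n1 n2 n3} i.
Arguments L3b {n1 n2 n3} i.
Arguments L3c {n1 n2 n3} i.
Arguments L3t {n1 n2 n3}.

Section L3Lattice.
Variables n1 n2 n3 : nat.
Local Notation T := (L3 n1 n2 n3).

Definition L3_enc (x : T) : option (option ('I_n1 + 'I_n2 + 'I_n3)) :=
  match x with
  | L3s => None
  | L3t => Some None
  | L3a i => Some (Some (inl (inl i)))
  | L3b i => Some (Some (inl (inr i)))
  | L3c i => Some (Some (inr i))
  end.

Definition L3_dec (u : option (option ('I_n1 + 'I_n2 + 'I_n3))) : T :=
  match u with
  | None => L3s
  | Some None => L3t
  | Some (Some (inl (inl i))) => L3a i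
  | Some (Some (inl (inr i))) => L3b i
  | Some (Some (inr i)) => L3c i
  end.

Lemma L3_encK : cancel L3_enc L3_dec. Proof. by case. Qed.

HB.instance Definition _ := Equality.copy T (can_type L3_encK).
HB.instance Definition _ := Choice.copy T (can_type L3_encK).
HB.instance Definition _ := Countable.copy T (can_type L3_encK).
HB.instance Definition _ := Finite.copy T (can_type L3_encK).

Definition L3_le (x y : T) : bool :=
  match x, y with
  | L3s, _ | _, L3t => true
  | L3a i, L3a j => i <= j
  | L3b i, L3b j => i <= j
  | L3c i, L3c j => i <= j
  | _, _ => false
  end.

Lemma L3_le_refl : reflexive L3_le.
Proof. by case=> //= i. Qed.

Lemma L3_le_anti : antisymmetric L3_le.
Proof. by case=> [|i|i|i|] [|j|j|j|] //= /anti_leq/val_inj ->. Qed.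

Lemma L3_le_trans : transitive L3_le.
Proof. by case=> [|j|j|j|] [|i|i|i|] [|k|k|k|] //=; apply: leq_trans. Qed.

Fact L3_display : Order.disp_t. Proof. exact: Order.Disp tt tt. Qed.

HB.instance Definition _ := Order.Le_isPOrder.Build L3_display T
  L3_le_refl L3_le_anti L3_le_trans.

Definition L3_meet (x y : T) : T :=
  if L3_le x y then x else if L3_le y x then y else L3s.

Definition L3_join (x y : T) : T :=
  if L3_le x y then y else if L3_le y x then x else L3t.

Lemma L3_lexI (x y z : T) :
  L3_le x (L3_meet y z) = L3_le x y && L3_le x z.
Proof.
rewrite /L3_meet; have [yz|Nyz] := ifPn.
  by case xy: (L3_le x y) => //=; rewrite (L3_le_trans xy).
have [zy|Nzy] := ifPn.
  by case xz: (L3_le x z); rewrite ?andbF // (L3_le_trans xz zy).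
move: Nyz Nzy; case: x y z => [|i|i|i|] [|j|j|j|] [|k|k|k|] //=;
  by rewrite ?andbF // -ltnNge => /ltnW ->.
Qed.

Lemma L3_leUx (x y z : T) :
  L3_le (L3_join x y) z = L3_le x z && L3_le y z.
Proof.
rewrite /L3_join; have [xy|Nxy] := ifPn.
  by case yz: (L3_le y z); rewrite ?andbF // (L3_le_trans xy yz).
have [yx|Nyx] := ifPn.
  by case xz: (L3_le x z) => //=; rewrite (L3_le_trans yx).
move: Nxy Nyx; case: x y z => [|i|i|i|] [|j|j|j|] [|k|k|k|] //=;
  by rewrite ?andbF // -ltnNge => /ltnW ->.
Qed.

HB.instance Definition _ :=
  Order.POrder_isMeetSemilattice.Build L3_display T L3_lexI.
HB.instance Definition _ :=
  Order.POrder_isJoinSemilattice.Build L3_display T L3_leUx.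

Lemma card_L3 : #|{: T}| = n1 + n2 + n3 + 2.
Proof.
have encB : bijective L3_enc.
  exists L3_dec; first exact: L3_encK.
  by case=> [[[[]|]|]|].
rewrite (bij_eq_card encB) !card_option !card_sum !card_ord.
by rewrite addn2.
Qed.

(* The defining relations s < a_1 < ... < a_n1 < t, and likewise for b, c. *)
Definition L3_step (x y : T) : bool :=
  match x, y with
  | L3s, L3a i => val i == 0
  | L3s, L3b i => val i == 0
  | L3s, L3c i => val i == 0
  | L3a i, L3a j => val j == i.+1
  | L3b i, L3b j => val j == i.+1
  | L3c i, L3c j => val j == i.+1
  | L3a i, L3t => i.+1 == n1
  | L3b i, L3t => i.+1 == n2
  | L3c i, L3t => i.+1 == n3
  | _, _ => false
  end.

Lemma L3_le_step (x y : T) :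
  0 < n1 -> (x <= y)%O = connect L3_step x y.
Proof.
move=> n1_gt0.
have chain n (f : 'I_n -> T) :
    (forall i j : 'I_n, val j = i.+1 -> L3_step (f i) (f j)) ->
  forall i j : 'I_n, i <= j -> connect L3_step (f i) (f j).
  move=> fS i [j ltjn] /=; elim: j ltjn => [|j IHj] ltjn.
    rewrite leqn0 => /eqP i0.
    by rewrite (_ : i = Ordinal ltjn) ?connect0 //; apply: val_inj.
  rewrite leq_eqVlt => /predU1P[ij|].
    by rewrite (_ : i = Ordinal ltjn) ?connect0 //; apply: val_inj.
  rewrite ltnS => leij; apply: connect_trans (IHj (ltnW ltjn) leij) _.
  by apply/connect1/fS.
have bottom n (f : 'I_n -> T) :
    (forall i j : 'I_n, val j = i.+1 -> L3_step (f i) (f j)) ->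
    (forall i : 'I_n, val i = 0 -> L3_step L3s (f i)) ->
  forall i : 'I_n, connect L3_step L3s (f i).
  move=> fS f0 i; have n_gt0 : 0 < n by apply: leq_ltn_trans (ltn_ord i).
  apply: (@connect_trans _ _ (f (Ordinal n_gt0))); first exact/connect1/f0.
  exact: chain.
have top n (f : 'I_n -> T) :
    (forall i j : 'I_n, val j = i.+1 -> L3_step (f i) (f j)) ->
    (forall i : 'I_n, i.+1 = n -> L3_step (f i) L3t) ->
  forall i : 'I_n, connect L3_step (f i) L3t.
  move=> fS fn i; have n_gt0 : 0 < n by apply: leq_ltn_trans (ltn_ord i).
  have ltn : n.-1 < n by rewrite prednK.
  apply: (@connect_trans _ _ (f (Ordinal ltn))).
    by apply: chain => //=; rewrite -ltnS prednK.
  by apply/connect1/fn; rewrite /= prednK.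
apply/idP/idP; last first.
  case/connectP=> p; elim: p x => [|z p IHp] x /=; first by move=> _ ->.
  case/andP=> xz zp yp; apply: le_trans (IHp z zp yp).
  case: x z xz {zp yp} => [|i|i|i|] [|j|j|j|] //= /eqP ij;
    by rewrite /Order.le /= ij.
rewrite /Order.le /=; case: x y => [|i|i|i|] [|j|j|j|] //=.
all: try by move=> _; exact: connect0.
all: try by apply: chain => u v /= /eqP.
all: try by move=> _; apply: bottom => [u v|u] /= /eqP.
all: try by move=> _; apply: top => [u v|u] /= /eqP.
move=> _; apply: (@connect_trans _ _ (L3a (Ordinal n1_gt0))).
  exact: connect1.
by apply: top => [u v|u] /= /eqP.
Qed.

End L3Lattice.

(* Main.v *)
From HB Require Import structures.
Require Import Defs.
From mathcomp Require Import all_boot all_order all_algebra.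
From mathcomp Require Import mpoly ring.

Set Implicit Arguments.
Unset Strict Implicit.
Unset Printing Implicit Defensive.

Import Order.TTheory GRing.Theory.

(** The ideal is radical for all positive lengths of the three chains.  Write
    a_i, b_j, c_k, s, t for the variables and u = s t, so that the ideal I is
    generated by the differences v v' - u, where v v' is a mixed product: v and
    v' are variables on distinct chains.

    The zero set of I has two parts.  Where u = 0, all mixed products vanish,
    so two of the three chains vanish and one of s, t vanishes: six coordinate
    subspaces.  Where u is invertible, u a_i = a_i b_j c_k = u b_j and its
    analogues force all the chain variables to take one value x with x^2 = s t;
    this surface is parametrized by s = y^2, t = z^2, x = y z.  These seven
    pieces give seven ring morphisms into domains that kill I, hence kill every
    p of its radical.  It remains to see that such a p is in I.

    The six coordinate subspaces leave in p only monomials divisible by s t or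
    by a mixed product (radical_coeff0), and each of these is a multiple of u
    modulo I (radical_u_multiple): p = u g modulo I.

    The parametrization sends u to y^2 z^2, which is not zero, so it kills g.
    On the other hand multiplication by u identifies all the chain variables
    modulo I (collapse_chains) and the product of any two of them with u
    (collapse_square).  Therefore u m, for a monomial m, depends modulo I only
    on the image of m in K[y, z] (mon_section_congr), and u g is in I as soon
    as g has image 0 (weight_subst_ker). *)

(** * Generated ideals *)

Section GeneratedIdeal.
Local Open Scope ring_scope.
Variables (R : comNzRingType) (G : R -> Prop).
Local Notation I := (generated_ideal G).

Lemma generated_ideal_gen p : G p -> I p.
Proof.
move=> Gp; exists [:: (1, p)] => [u|]; first by rewrite inE => /eqP ->.
by rewrite big_seq1 mul1r.
Qed.

Lemma generated_ideal0 : I 0.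
Proof. by exists [::]; [move=> u; rewrite in_nil | rewrite big_nil]. Qed.

Lemma generated_idealD p q : I p -> I q -> I (p + q).
Proof.
move=> [c Gc ->] [e Ge ->]; exists (c ++ e); last by rewrite big_cat.
by move=> u; rewrite mem_cat => /orP[/Gc|/Ge].
Qed.

Lemma generated_idealMl a p : I p -> I (a * p).
Proof.
move=> [c Gc ->]; exists [seq (a * u.1, u.2) | u <- c].
  by move=> _ /mapP[u uc ->]; exact: Gc uc.
by rewrite big_map mulr_sumr; apply: eq_bigr => u _; rewrite mulrA.
Qed.

Lemma generated_idealN p : I p -> I (- p).
Proof. by move=> Ip; rewrite -mulN1r; apply: generated_idealMl. Qed.

Lemma generated_ideal_sum (T : eqType) (r : seq T) (F : T -> R) :
  (forall i, i \in r -> I (F i)) -> I (\sum_(i <- r) F i).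
Proof.
move=> IF; rewrite big_seq; elim/big_ind: _ => //.
  exact: generated_ideal0.
exact: generated_idealD.
Qed.

Lemma rmorph_generated_ideal0 (S : comNzRingType) (f : {rmorphism R -> S}) p :
  (forall q, G q -> f q = 0) -> I p -> f p = 0.
Proof.
move=> fG [c Gc ->]; rewrite rmorph_sum /= big_seq big1 // => u /Gc /fG fu0.
by rewrite rmorphM fu0 mulr0.
Qed.

Lemma rmorph_radical0 (S : idomainType) (f : {rmorphism R -> S}) p :
  (forall q, G q -> f q = 0) -> radical I p -> f p = 0.
Proof.
move=> fG [m m_gt0 /(rmorph_generated_ideal0 fG)/eqP].
by rewrite rmorphXn expf_eq0 m_gt0 => /eqP.
Qed.

Lemma radical_sub p : I p -> radical I p.
Proof. by move=> Ip; exists 1. Qed.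

End GeneratedIdeal.

(** * Substitutions in the polynomial ring of a lattice *)

Section LatticeSubstitution.
Local Open Scope ring_scope.
Variables (K : fieldType) (d : Order.disp_t) (L : finLatticeType d) (k : nat).
Variable h : L -> {mpoly K[k]}.

Definition lat_subst : {mpoly K[#|L|]} -> {mpoly K[k]} :=
  mmap (@mpolyC k K) (fun i => h (enum_val i)).

HB.instance Definition _ := GRing.RMorphism.copy lat_subst
  (mmap (@mpolyC k K) (fun i => h (enum_val i))).

Lemma lat_substX m :
  lat_subst 'X_[m] = \prod_i h (enum_val i) ^+ m i.
Proof. by rewrite /lat_subst mmapX. Qed.

Lemma lat_subst_latvar l : lat_subst (latvar K l) = h l.
Proof. by rewrite /lat_subst /latvar mmapX mmap1U enum_rankK. Qed.

Lemma lat_substE p :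
  lat_subst p = \sum_(m <- msupp p) p@_m *: lat_subst 'X_[m].
Proof.
rewrite {1}[p]mpolyE rmorph_sum /=; apply: eq_bigr => m _.
by rewrite /lat_subst mmapZ mul_mpolyC.
Qed.

(** Both families of morphisms enter through this criterion: the values of the
    variables have only to satisfy the join-meet relations, the target being a
    domain. *)
Lemma lat_subst_radical0 p :
    (forall a b, h a * h b = h (Order.join a b) * h (Order.meet a b)) ->
  radical (join_meet_ideal K L) p -> lat_subst p = 0.
Proof.
move=> hM; apply: (@rmorph_radical0 _ _ _ lat_subst) => _ [a [b ->]].
by rewrite rmorphB !rmorphM /= !lat_subst_latvar hM subrr.
Qed.

End LatticeSubstitution.

(** * Coordinate subspaces *)

Lemma mnm_factor n (m : 'X_{1..n}) i :
  m i != 0 -> exists m', m = (U_(i) + m')%MM.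
Proof.
move=> mi; exists (m - U_(i))%MM; rewrite addmC submK //.
by apply/mnm_lepP=> j; rewrite mnm1E; case: eqP => // <-; rewrite lt0n.
Qed.

Section Facets.
Local Open Scope ring_scope.
Variables (K : fieldType) (d : Order.disp_t) (L : finLatticeType d).

Definition mon_supported (F : pred L) (m : 'X_{1..#|L|}) :=
  [forall i, (m i != 0%N) ==> F (enum_val i)].

(** The hypothesis says that the subspace on which all variables outside F
    vanish lies in the zero set of the join-meet ideal.  Restriction to that
    subspace keeps the coefficients of the monomials supported in F, and maps
    the radical to 0. *)
Lemma radical_coeff0 (F : pred L) p m :
    (forall a b, ~~ (a >=< b)%O ->
       ~~ (F a && F b) /\ ~~ (F (Order.join a b) && F (Order.meet a b))) ->
    mon_supported F m ->
  radical (join_meet_ideal K L) p -> p@_m = 0.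
Proof.
move=> Finc /forallP Fm radp.
pose h l := if F l then latvar K l else 0.
have hM a b : h a * h b = h (Order.join a b) * h (Order.meet a b).
  have [/orP[ab|ba]|/Finc[]] := boolP (a >=< b)%O.
  - by rewrite join_r // meet_l // mulrC.
  - by rewrite join_l // meet_r.
  by rewrite /h; do 4!case: (F _); rewrite ?mul0r ?mulr0.
have := congr1 (mcoeff m) (lat_subst_radical0 hM radp).
rewrite mcoeff0 => <-; rewrite lat_substE {1}[p]mpolyE !raddf_sum /=.
apply: eq_bigr => n _; rewrite !mcoeffZ; congr (_ * _).
have [Fn|] := boolP (mon_supported F n).
  (* Outside F the variable goes to 0, but there the exponent is 0 too. *)
  rewrite lat_substX mpolyXE_id; congr (_@_m); apply: eq_bigr => i _.
  rewrite /h; have := forallP Fn i; case: (m i =P 0%N) => [|_] /=.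
    case: (n i =P 0%N) => [->|_ _ /= ->]; first by rewrite !expr0.
    by rewrite /latvar enum_valK.
  case: (n i =P 0%N) => [->|_ /= ->]; first by rewrite !expr0.
  by rewrite /latvar enum_valK.
rewrite negb_forall => /existsP[i]; rewrite negb_imply => /andP[ni0 Fi].
have -> : lat_subst h 'X_[n] = 0.
  rewrite lat_substX (bigD1 i) //= /h (negPf Fi) expr0n (negPf ni0).
  by rewrite mul0r.
rewrite mcoeff0 mcoeffX; case: eqP => // nm.
by have := Fm i; rewrite -nm ni0 (negPf Fi).
Qed.

Lemma mon_supportedPn (F : pred L) (m : 'X_{1..#|L|}) :
  ~~ mon_supported F m -> exists2 l, m (enum_rank l) != 0%N & ~~ F l.
Proof.
rewrite negb_forall => /existsP[i]; rewrite negb_imply => /andP[mi Fi].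
by exists (enum_val i); rewrite ?enum_valK.
Qed.

End Facets.

(** * Reduction modulo the ideal to multiples of s t *)

Section ThreeChains.
Local Open Scope ring_scope.
Variables (K : fieldType) (n1 n2 n3 : nat).
Hypotheses (n1_gt0 : (0 < n1)%N) (n2_gt0 : (0 < n2)%N) (n3_gt0 : (0 < n3)%N).
Local Notation L := (L3 n1 n2 n3).
Local Notation I := (join_meet_ideal K L).
Local Notation X := (latvar K).
Local Notation s := (X (L3s : L)).
Local Notation t := (X (L3t : L)).
Local Notation u := (s * t).

Definition chain_of (l : L) : option nat :=
  match l with
  | L3a _ => Some 0%N
  | L3b _ => Some 1%N
  | L3c _ => Some 2%N
  | _ => None
  end.

Definition on_distinct_chains (l l' : L) :=
  [&& chain_of l != None, chain_of l' != None & chain_of l != chain_of l'].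

Lemma on_distinct_chainsE (l l' : L) :
  on_distinct_chains l l' -> Order.join l l' = L3t /\ Order.meet l l' = L3s.
Proof. by case: l l' => [|i|i|i|] [|j|j|j|]. Qed.

Lemma incomparable_distinct_chains (l l' : L) :
  ~~ (l >=< l')%O -> on_distinct_chains l l'.
Proof.
by case: l l' => [|i|i|i|] [|j|j|j|] //=; rewrite /Order.comparable /Order.le
  /= leq_total.
Qed.

Lemma mixed_product (l l' : L) : on_distinct_chains l l' -> I (X l * X l' - u).
Proof.
move=> /on_distinct_chainsE[jE mE]; apply: generated_ideal_gen.
by exists l, l'; rewrite jE mE [t * s]mulrC.
Qed.

Lemma third_chain (l l' : L) : chain_of l != None -> chain_of l' != None ->
  exists e, on_distinct_chains l e /\ on_distinct_chains l' e.
Proof.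
pose a := L3a (Ordinal n1_gt0) : L; pose b := L3b (Ordinal n2_gt0) : L.
pose c := L3c (Ordinal n3_gt0) : L.
by case: l l' => [|i|i|i|] [|j|j|j|] // _ _;
  [exists b | exists c | exists b | exists c | exists a | exists a
  | exists b | exists a | exists a].
Qed.

(** Multiplied by a variable on a third chain, both l and l' become u; hence
    u l = l (l' e) = l' (l e) = u l' for e on a chain distinct from theirs. *)
Lemma collapse_chains (l l' : L) : chain_of l != None -> chain_of l' != None ->
  I (u * (X l - X l')).
Proof.
move=> cl cl'; have [e [le l'e]] := third_chain cl cl'.
have -> : u * (X l - X l') =
    X l' * (X l * X e - u) + - (X l * (X l' * X e - u)) by ring.
by apply: generated_idealD; [|apply: generated_idealN];
  apply/generated_idealMl/mixed_product.
Qed.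

(** In the presence of u, the factor l' can be replaced by some e whose chain
    is not that of l, and then l e = u: this covers l and l' on one chain. *)
Lemma collapse_square (l l' : L) : chain_of l != None -> chain_of l' != None ->
  I (u * (X l * X l' - u)).
Proof.
move=> cl cl'; have [e [le l'e]] := third_chain cl cl'.
have ce : chain_of e != None by case/and3P: le.
have -> : u * (X l * X l' - u) =
    X l * (u * (X l' - X e)) + u * (X l * X e - u) by ring.
apply: generated_idealD; apply: generated_idealMl; last exact: mixed_product.
exact: collapse_chains.
Qed.

(** For c < 3 and z one of s, t, the variables that do not vanish identically on
    one of the six coordinate subspaces in the zero set of the ideal. *)
Definition facet (c : nat) (z l : L) := (chain_of l == Some c) || (l == z).

Lemma facet_incomparable c z (l l' : L) :
    z \in [:: L3s; L3t] -> ~~ (l >=< l')%O ->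
  ~~ (facet c z l && facet c z l')
  /\ ~~ (facet c z (Order.join l l') && facet c z (Order.meet l l')).
Proof.
move=> zst /incomparable_distinct_chains ll'.
have [-> ->] := on_distinct_chainsE ll'; split; last first.
  by move: zst; rewrite !inE => /orP[]/eqP->.
have /and3P[cl cl' ne] := ll'; rewrite /facet.
have chain_z y : chain_of y != None -> (y == z) = false.
  by move: zst; rewrite !inE => /orP[]/eqP->; case: y.
rewrite !chain_z // !orbF; apply/negP=> /andP[/eqP lc /eqP l'c].
by rewrite lc l'c eqxx in ne.
Qed.

Definition u_multiple p := exists g, I (p - u * g).

Lemma pair_u_multiple (m : 'X_{1..#|{: L}|}) l l' :
    l != l' -> m (enum_rank l) != 0%N -> m (enum_rank l') != 0%N ->
    I (X l * X l' - u) ->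
  u_multiple 'X_[m].
Proof.
move=> ne ml ml' Ill'.
have [m1 mE] := mnm_factor ml.
have [|m2 m1E] := @mnm_factor _ m1 (enum_rank l').
  move: ml'; rewrite mE mnmDE mnm1E (inj_eq enum_rank_inj).
  by rewrite (negPf ne).
rewrite mE m1E !mpolyXD -!/(latvar K _).
exists 'X_[m2].
have -> : X l * (X l' * 'X_[m2]) - u * 'X_[m2]
  = 'X_[m2] * (X l * X l' - u) by ring.
exact: generated_idealMl.
Qed.

(** A support contained in no facet has both ends s and t, or else two elements
    of distinct chains: if only the end z may occur, the facets on z over each
    chain in turn are avoided only in this way. *)
Lemma mon_u_multiple (m : 'X_{1..#|{: L}|}) :
    (forall c z, z \in [:: L3s; L3t] -> ~~ mon_supported (facet c z) m) ->
  u_multiple 'X_[m].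
Proof.
move=> mF.
have [/andP[ms mt]|nst] :=
    boolP ((m (enum_rank (L3s : L)) != 0%N)
           && (m (enum_rank (L3t : L)) != 0%N)).
  apply: (@pair_u_multiple _ (L3s : L) (L3t : L)) => //; rewrite subrr.
  exact: generated_ideal0.
have [z zst mz] : exists2 z : L, z \in [:: L3s; L3t]
    & forall l : L, chain_of l = None -> m (enum_rank l) != 0%N -> l = z.
  move: nst; rewrite negb_and !negbK => /orP[] /eqP m0.
    by exists L3t => //; case=> //; rewrite m0.
  by exists L3s => //; case=> //; rewrite m0.
have chain_supp c : exists2 l : L, m (enum_rank l) != 0%N
    & (chain_of l != None) && (chain_of l != Some c).
  have [l ml] := mon_supportedPn (mF c z zst); rewrite negb_or => /andP[lc lz].
  exists l => //; rewrite lc andbT; apply: contra lz => /eqP cl.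
  exact/eqP/mz.
(* The chain numbered 0 is an arbitrary choice: it yields a first chain
   variable l, and the chain of l then yields one off that chain. *)
have [l ml /andP[cl _]] := chain_supp 0%N.
case lc: (chain_of l) cl => [c|] // _.
have [l' ml' /andP[cl' l'c]] := chain_supp c.
have ll' : on_distinct_chains l l'.
  by rewrite /on_distinct_chains cl' lc /= eq_sym l'c.
apply: (pair_u_multiple _ ml ml' (mixed_product ll')).
by apply: contraNneq l'c => <-; rewrite lc.
Qed.

Lemma radical_u_multiple p : radical I p -> u_multiple p.
Proof.
move=> radp; rewrite [p]mpolyE big_seq; elim/big_ind: _ => [|q r|m mp].
- by exists 0; rewrite mulr0 subr0; apply: generated_ideal0.
- move=> [g Ig] [g' Ig']; exists (g + g').
  have -> : q + r - u * (g + g') = (q - u * g) + (r - u * g') by ring.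
  exact: generated_idealD.
have [c z zst|g Ig] := @mon_u_multiple m.
  apply: contraL mp => Fm; rewrite mcoeff_msupp negbK; apply/eqP.
  by apply: radical_coeff0 Fm radp => a b; apply: facet_incomparable.
exists (p@_m *: g); rewrite -!mul_mpolyC.
have -> : (p@_m)%:MP * 'X_[m] - u * ((p@_m)%:MP * g)
  = (p@_m)%:MP * ('X_[m] - u * g) by ring.
exact: generated_idealMl.
Qed.

(** * The component through the points with s t invertible *)

(** The exponents of the parametrization s = y^2, t = z^2, v = y z for every
    chain variable v. *)
Definition weight (l : L) : 'X_{1..2} :=
  match l with
  | L3s => (U_(ord0) + U_(ord0))%MM
  | L3t => (U_(ord_max) + U_(ord_max))%MM
  | _ => (U_(ord0) + U_(ord_max))%MM
  end.

Definition mon_weight (m : 'X_{1..#|{: L}|}) : 'X_{1..2} :=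
  (\sum_i weight (enum_val i) *+ m i)%MM.

(** A lift of y^p z^q along the parametrization when p and q have the same
    parity, as is the case for all weights of monomials: pairs of y and of z
    come from s and t, a remaining y z from the chain variable a_1. *)
Definition mon_section (w : 'X_{1..2}) : {mpoly K[#|{: L}|]} :=
  s ^+ (w ord0)./2 * t ^+ (w ord_max)./2
  * X (L3a (Ordinal n1_gt0) : L) ^+ odd (w ord0).

Lemma mon_weightD m m' :
  mon_weight (m + m') = (mon_weight m + mon_weight m')%MM.
Proof.
rewrite /mon_weight -big_split; apply: eq_bigr => i _ /=.
by apply/mnmP=> j; rewrite !(mnmDE, mulmnE) mulnDr.
Qed.

Lemma mon_weightU l : mon_weight U_(enum_rank l) = weight l.
Proof.
rewrite /mon_weight (bigD1 (enum_rank l)) //= big1 => [|i].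
  by rewrite mnm1E eqxx enum_rankK addm0; apply/mnmP=> j; rewrite mulmnE muln1.
by rewrite mnm1E eq_sym => /negPf->; apply: mulm0n.
Qed.

Lemma mon_weight_parity m :
  odd (mon_weight m ord0) = odd (mon_weight m ord_max).
Proof.
apply: (big_ind (fun w : 'X_{1..2} => odd (w ord0) = odd (w ord_max)))
  => [|v w ev ew|i _].
- by rewrite !mnm0E.
- by rewrite !mnmDE !oddD ev ew.
rewrite !mulmnE !oddM; case: (enum_val i) => [|j|j|j|] /=;
  by rewrite ?mulmnE ?mnmDE !mnm1E.
Qed.

(** When the section has no factor a_1, a new chain variable is turned into a_1
    by collapse_chains; when it has one, the two together are turned into s t by
    collapse_square, in step with the carry in the halves of the exponents. *)
Lemma section_step l (w : 'X_{1..2}) : odd (w ord0) = odd (w ord_max) ->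
  I (u * (X l * mon_section w - mon_section (weight l + w)%MM)).
Proof.
set x := X (L3a (Ordinal n1_gt0) : L).
have chain_step l' : chain_of l' != None -> odd (w ord0) = odd (w ord_max) ->
    I (u * (X l' * mon_section w
            - mon_section (U_(ord0) + U_(ord_max) + w)%MM)).
  move=> cl' par; rewrite /mon_section !mnmDE !mnm1E /=.
  rewrite !add0n !uphalf_half -par; case: (odd _) => /=.
    set A := s ^+ _; set B := t ^+ _.
    have -> : u * (X l' * (A * B * x ^+ 1)
        - s ^+ (1 + (w ord0)./2) * t ^+ (1 + (w ord_max)./2) * x ^+ 0)
      = A * B * (u * (X l' * x - u)).
      by rewrite !exprS -/A -/B; ring.
    exact/generated_idealMl/collapse_square.
  set A := s ^+ _; set B := t ^+ _.
  have -> : u * (X l' * (A * B * x ^+ 0) - A * B * x ^+ 1)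
    = A * B * (u * (X l' - x)) by ring.
  exact/generated_idealMl/collapse_chains.
case: l => [|i|i|i|] par; try exact: chain_step.
  rewrite /mon_section /= !mnmDE !mnm1E /= !add0n negbK exprS.
  set p := (X in I X); have -> : p = 0 by rewrite /p; ring.
  exact: generated_ideal0.
rewrite /mon_section /= !mnmDE !mnm1E /= !add0n exprS.
set p := (X in I X); have -> : p = 0 by rewrite /p; ring.
exact: generated_ideal0.
Qed.

Lemma mon_section_congr m : I (u * ('X_[m] - mon_section (mon_weight m))).
Proof.
have [n] := ubnP (mdeg m); elim: n m => // n IHn m; rewrite ltnS => mn.
have [m0|] := boolP [forall i, m i == 0%N].
  have -> : m = 0%MM by apply/mnmP=> i; rewrite mnm0E; apply/eqP/(forallP m0).
  have -> : mon_weight 0 = 0%MM.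
    by rewrite /mon_weight big1 // => i _; rewrite mnm0E mulm0n.
  rewrite /mon_section !mnm0E mpolyX0 !expr0 !mulr1 subrr mulr0.
  exact: generated_ideal0.
rewrite negb_forall => /existsP[i mi].
have [m' mE] := mnm_factor mi; rewrite mE mpolyXD mon_weightD.
have := mon_weightU (enum_val i); rewrite enum_valK => ->.
set w := mon_weight m'; have -> : 'X_i = X (enum_val i : L).
  by rewrite /latvar enum_valK.
set v := X (enum_val i : L); set v' := mon_section (_ + _).
have -> : u * (v * 'X_[m'] - v') =
    v * (u * ('X_[m'] - mon_section w)) + u * (v * mon_section w - v') by ring.
apply: generated_idealD; last exact/section_step/mon_weight_parity.
apply/generated_idealMl/IHn; apply: leq_trans mn.
by rewrite mE mdegD mdeg1.
Qed.

Definition weight_subst : {mpoly K[#|{: L}|]} -> {mpoly K[2]} :=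
  lat_subst (fun l : L => 'X_[weight l]).

HB.instance Definition _ := GRing.RMorphism.copy weight_subst
  (lat_subst (fun l : L => 'X_[weight l] : {mpoly K[2]})).

Lemma weight_substX m : weight_subst 'X_[m] = 'X_[mon_weight m].
Proof.
rewrite /weight_subst lat_substX.
rewrite /mon_weight (big_morph _ (@mpolyXD 2 K) (@mpolyX0 2 K)).
by apply: eq_bigr => i _; rewrite mpolyXn.
Qed.

Lemma weight_subst_latvar l : weight_subst (X l) = 'X_[weight l].
Proof. exact: lat_subst_latvar. Qed.

Lemma weight_subst_radical0 p : radical I p -> weight_subst p = 0.
Proof.
apply: lat_subst_radical0 => a b.
have [/orP[ab|ba]|/incomparable_distinct_chains ab] := boolP (a >=< b)%O.
- by rewrite join_r // meet_l // mulrC.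
- by rewrite join_l // meet_r.
have [-> ->] := on_distinct_chainsE ab; rewrite -!mpolyXD; congr 'X_[_].
have chain_weight l :
  chain_of l != None -> weight l = (U_(ord0) + U_(ord_max))%MM by case: l.
have /and3P[ca cb _] := ab; rewrite (chain_weight a) // (chain_weight b) //=.
by apply/mnmP=> i; rewrite !mnmDE; ring.
Qed.

(** The section extends linearly to K[y, z], and u g is congruent to u times the
    section of the image of g. *)
Lemma weight_subst_ker g : weight_subst g = 0 -> I (u * g).
Proof.
move=> g0; pose k := (\max_(m <- msupp g) mdeg (mon_weight m)).+1.
have sec0 : \sum_(m <- msupp g) g@_m *: mon_section (mon_weight m) = 0.
  (* The sum is regrouped by weight; k bounds the degrees of the weights that
     occur, so that the index type is finite. *)
  transitivity
      (\sum_(w : 'X_{1..2 < k}) (weight_subst g)@_w *: mon_section w);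
    last by rewrite g0 big1 // => w _; rewrite mcoeff0 scale0r.
  rewrite /weight_subst lat_substE -/weight_subst.
  under [RHS]eq_bigr => w _ do rewrite raddf_sum scaler_suml /=.
  rewrite exchange_big; apply: eq_big_seq => m mg /=.
  have mk : (mdeg (mon_weight m) < k)%N by rewrite ltnS; apply: leq_bigmax_seq.
  rewrite (bigD1 (BMultinom mk)) //= big1 => [|w wm].
    by rewrite weight_substX mcoeffZ mcoeffX eqxx mulr1 addr0.
  rewrite weight_substX mcoeffZ mcoeffX; case: eqP => [mw|]; last first.
    by rewrite mulr0 scale0r.
  by case/eqP: wm; apply: val_inj.
have -> : u * g =
    \sum_(m <- msupp g) g@_m *: (u * ('X_[m] - mon_section (mon_weight m))).
  transitivity (u * (g - 0)); first by rewrite subr0.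
  rewrite -[X in g - X]sec0 {1}[g]mpolyE -sumrB mulr_sumr.
  by apply: eq_bigr => m _; rewrite -scalerBr scalerAr.
apply: generated_ideal_sum => m _; rewrite -mul_mpolyC.
exact/generated_idealMl/mon_section_congr.
Qed.

Lemma L3_join_meet_radical : radical_ideal I.
Proof.
move=> p; split; last exact: radical_sub.
move=> radp; have [g Ig] := radical_u_multiple radp.
rewrite -(subrK (u * g) p); apply: generated_idealD => //.
apply: weight_subst_ker; apply/eqP.
have := weight_subst_radical0 (radical_sub Ig).
rewrite rmorphB /= (weight_subst_radical0 radp) sub0r rmorphM => /eqP.
rewrite oppr_eq0 mulf_eq0 => /orP[|//].
rewrite rmorphM /= !weight_subst_latvar -mpolyXD => /eqP uE.
(* The image of u is a monomial, hence not 0. *)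
have := congr1 (mcoeff (weight (L3s : L) + weight (L3t : L))%MM) uE.
by rewrite mcoeffX eqxx mcoeff0 => /eqP; rewrite oner_eq0.
Qed.
End ThreeChains.

Theorem theorem1p2 (K : fieldType) (n1 n2 n3 : nat)
    (hn : [/\ 2 <= n1 <= 10, n2 = 1 & n3 = 1]
       \/ [/\ 2 <= n1 <= 4, 2 <= n2 <= 4 & n3 = 1]
       \/ [/\ 2 <= n1 <= 3, 2 <= n2 <= 3 & 2 <= n3 <= 3]) :
  radical_ideal (join_meet_ideal K (L3 n1 n2 n3)).
Proof.
have pos m b : 2 <= m <= b -> 0 < m by case/andP=> /ltnW.
case: hn => [[/pos ? -> ->]|[[/pos ? /pos ? ->]|[/pos ? /pos ? /pos ?]]].
all: exact: L3_join_meet_radical.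
Qed.
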